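(* Let $\epsilon>0$. For every function $f:[\epsilon,2\epsilon)\to\mathbb{R}$ there is a unique function $y:(0,\infty)\to\mathbb{R}$ such that $y(x)=y(2x)$ for all $x\in(0,\infty)$ and $y(x)=f(x)$ for all $x\in[\epsilon,2\epsilon)$.
   Context: No continuity is assumed. *)

(* Defs.v *)
From mathcomp Require Import all_boot all_order all_algebra.
From mathcomp Require Import all_classical all_reals.
Set Implicit Arguments.
Unset Strict Implicit.
Unset Printing Implicit Defensive.
Import Order.TTheory GRing.Theory Num.Theory.
Local Open Scope classical_set_scope.
Local Open Scope ring_scope.

(* A set used as a type is [set_type], so a function on an interval takes only
   the points of that interval as arguments. *)
Definition pos_reals (R : realType) : set R := `]0, +oo[.
Arguments pos_reals R : clear implicits.

Definition octave (R : realType) (eps : R) : set R := `[eps, 2 * eps[.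

Lemma double_subproof (R : realType) (x : pos_reals R) :
  2 * \val x \in pos_reals R.
Proof.
have := set_mem (valP x); rewrite inE /pos_reals /= !in_itv /= !andbT.
by move=> x_gt0; rewrite mulr_gt0.
Qed.

Definition double_pos (R : realType) (x : pos_reals R) : pos_reals R :=
  SigSub (double_subproof x).

Lemma octave_pos_subproof (R : realType) (eps : R) (eps_gt0 : 0 < eps)
  (x : octave eps) : \val x \in pos_reals R.
Proof.
have := set_mem (valP x); rewrite inE /octave /pos_reals /= !in_itv /= andbT.
by move=> /andP[le_eps_x _]; apply: lt_le_trans le_eps_x.
Qed.

Definition octave_pos (R : realType) (eps : R) (eps_gt0 : 0 < eps)
    (x : octave eps) : pos_reals R :=
  SigSub (octave_pos_subproof eps_gt0 x).

(* Main.v *)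
(** Every orbit of x |-> 2 x on the positive reals meets [eps, 2 eps) in exactly
    one point, so y is forced to be f of that point, and this choice is
    constant along orbits. *)
Require Import Defs.
From mathcomp Require Import all_boot all_order all_algebra.
From mathcomp Require Import all_classical all_reals.
Set Implicit Arguments.
Unset Strict Implicit.
Unset Printing Implicit Defensive.
Import Order.TTheory GRing.Theory Num.Theory.
Local Open Scope classical_set_scope.
Local Open Scope ring_scope.

(** Doubling splits the positive reals into orbits, the classes of [dyadic_equiv], and
    [[eps, 2 * eps)] is a fundamental domain: it meets each class ([exists_octave_equiv]) only once
    ([octave_equiv_inj]). An invariant [y] is constant on classes ([double_invariant_equiv]), hence
    determined by [f]; conversely [f] composed with a choice of representatives is invariant. *)

(* Two nonnegative exponents stand for one integer exponent [n - m]. *)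
Definition dyadic_equiv (R : realType) (x t : R) : Prop :=
  exists m n : nat, 2 ^+ m * x = 2 ^+ n * t.

Lemma dyadic_equiv_sym (R : realType) (x t : R) :
  dyadic_equiv x t -> dyadic_equiv t x.
Proof. by move=> [m [n xt]]; exists n, m. Qed.

Lemma dyadic_equiv_trans (R : realType) (x s t : R) :
  dyadic_equiv x s -> dyadic_equiv s t -> dyadic_equiv x t.
Proof.
move=> [m [n xs]] [p [q st]]; exists (p + m)%N, (n + q)%N.
by rewrite !exprD -!mulrA xs -st mulrCA.
Qed.

Lemma pos_reals_gt0 (R : realType) (x : pos_reals R) : 0 < \val x.
Proof. by have := set_mem (valP x); rewrite /pos_reals /= in_itv /= andbT. Qed.

Lemma octave_bounds (R : realType) (eps : R) (t : octave eps) :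
  eps <= \val t < 2 * eps.
Proof. by have := set_mem (valP t); rewrite /octave /= in_itv. Qed.

Lemma exists_pow2_gt (R : realType) (a b : R) :
  0 < b -> exists n : nat, a < 2 ^+ n * b.
Proof.
move=> b_gt0; exists (Num.bound `|a / b|).
rewrite -ltr_pdivrMr //; apply: le_lt_trans (ler_norm _) _.
apply: lt_trans (archi_boundP (normr_ge0 _)) _.
by rewrite -natrX ltr_nat ltn_expl.
Qed.

(** Scale [x] up past [eps], then divide by the largest power of 2 that keeps it at least [eps]. *)
Lemma exists_octave_equiv (R : realType) (eps : R) (x : R) :
  0 < eps -> 0 < x -> exists t : octave eps, dyadic_equiv x (\val t).
Proof.
move=> eps_gt0 x_gt0.
have [m lt_eps] := exists_pow2_gt eps x_gt0.
set z := 2 ^+ m * x in lt_eps.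
have [|n lt_z min_n] := @ex_minnP (fun n => z < 2 ^+ n * eps).
  exact: exists_pow2_gt.
(* The least exponent is not 0 since [eps < z]; its predecessor is the power to divide by. *)
case: n lt_z min_n => [|n] lt_z min_n.
  by move: lt_z; rewrite mul1r ltNge ltW.
have le_z : 2 ^+ n * eps <= z.
  by rewrite leNgt; apply/negP => /min_n; rewrite ltnn.
have p_gt0 : 0 < 2 ^+ n :> R by rewrite exprn_gt0.
have t_in : z / 2 ^+ n \in octave eps.
  rewrite inE /octave /= in_itv /= ler_pdivlMr // ltr_pdivrMr //.
  by rewrite mulrC le_z mulrAC -exprS.
exists (SigSub t_in), m, n.
by rewrite /= mulrCA divff ?mulr1 // gt_eqF.
Qed.

(** If [s] is [t] times a positive power of 2, then [s >= 2 * t >= 2 * eps], outside the half-open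
    interval. *)
Lemma octave_equiv_inj (R : realType) (eps : R) (s t : octave eps) :
  0 < eps -> dyadic_equiv (\val s) (\val t) -> s = t.
Proof.
move=> eps_gt0 [m [n]]; wlog le_mn : s t m n / (m <= n)%N => [wl st|].
  by case/orP: (leq_total m n) => h; [|apply/esym]; apply: wl h _.
have p_neq0 : 2 ^+ m != 0 :> R by rewrite expf_neq0 ?pnatr_eq0.
rewrite -(subnKC le_mn) exprD -mulrA => /(mulfI p_neq0).
case: (n - m)%N => [|k] st; first by apply/val_inj; rewrite st mul1r.
have /andP[_] := octave_bounds s; have /andP[le_t _] := octave_bounds t.
rewrite ltNge st exprS -mulrA ler_pM2l // => /negP[].
apply: le_trans le_t _; rewrite ler_peMl ?exprn_ege1 ?ler1n //.
by apply: le_trans (ltW eps_gt0) _; have /andP[] := octave_bounds t.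
Qed.

Lemma val_iter_double (R : realType) (n : nat) (x : pos_reals R) :
  \val (iter n (@double_pos R) x) = 2 ^+ n * \val x.
Proof. by elim: n => [|n IHn] /=; rewrite ?mul1r // IHn mulrA -exprS. Qed.

(** Doubling [m] times from [x] and [n] times from [t] leads to the same point. *)
Lemma double_invariant_equiv (R : realType) (T : Type) (y : pos_reals R -> T)
    (x t : pos_reals R) :
  (forall u, y u = y (double_pos u)) -> dyadic_equiv (\val x) (\val t) ->
  y x = y t.
Proof.
move=> yD [m [n xt]].
have yI k u : y u = y (iter k (@double_pos R) u).
  by elim: k => //= k ->; apply: yD.
by rewrite (yI m) (yI n t); congr y; apply/val_inj; rewrite !val_iter_double.
Qed.

Theorem theorem3p4 (R : realType) (eps : R) (eps_gt0 : 0 < eps)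
    (f : octave eps -> R) :
  exists! y : pos_reals R -> R,
    (forall x : pos_reals R, y x = y (double_pos x)) /\
    (forall x : octave eps, y (octave_pos eps_gt0 x) = f x).
Proof.
have [rep repP] := choice (fun x : pos_reals R =>
  exists_octave_equiv eps_gt0 (pos_reals_gt0 x)).
exists (f \o rep); split; first split=> x /=.
(* The representatives of [x] and of its double lie in one class, so they coincide. *)
- congr f; apply: octave_equiv_inj => //.
  apply: dyadic_equiv_trans (dyadic_equiv_sym (repP x)) _.
  by apply: dyadic_equiv_trans (repP (double_pos x)); exists 1%N, 0%N;
    rewrite mul1r expr1.
- by congr f; apply/octave_equiv_inj/dyadic_equiv_sym => //;
    apply: repP (octave_pos eps_gt0 x).
move=> y [yD yf]; apply/funext => x /=.
(* [f (rep x)] is the value of [y] at [rep x], a point in the class of [x]. *)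
rewrite -yf; apply/esym/double_invariant_equiv => //.
Qed.
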